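(* Let $G$ be a finite connected bipartite graph without loops and multiple edges, with fixed bipartition of its vertex set into odd and even vertices, and suppose $r=(\mathrm{ind}(G))^2\ge 4$. Let $y_\bullet$ and $y_\circ$ be the odd and even standard vectors of $G$ (coming from one and the same principal eigenvector $y$), and let $t\in\mathbb{N}$, $t\ge 1$. Then $$c_{2t-1}(y_\circ)\simeq y_\circ+\frac{\sqrt r}{\rho_r(2t-1)}\,y_\bullet,\qquad c_{2t}(y_\circ)\simeq y_\circ+\frac{\rho_r(2t)}{\sqrt r}\,y_\bullet,$$ $$c_{-(2t+1)}(y_\bullet)\simeq y_\bullet+\frac{\sqrt r}{\rho_r(2t+1)}\,y_\circ,\qquad c_{-2t}(y_\bullet)\simeq y_\bullet+\frac{\rho_r(2t)}{\sqrt r}\,y_\circ .$$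
   Context: Let $G$ be a finite connected graph without loops and multiple edges, with vertices $G_v=\{g_1,\dots,g_n\}$; $M(g)$ denotes the set of vertices adjacent to $g$. $\mathrm{ind}(G)$ is the largest eigenvalue of the adjacency matrix $A_G$. The space $V_G$ consists of real vectors $x=(x_1,\dots,x_n)$, identified with functions $G_v\to\mathbb{R}$, $x_i=x(g_i)$. For connected $G$ the eigenvalue $\mathrm{ind}(G)$ is simple and has an eigenvector $y\in V_G$ with all coordinates positive, called the principal eigenvector (unique up to scaling). $G$ is bipartite: $G_v$ is a disjoint union of the set of odd vertices $\{g_1,\dots,g_p\}$ and the set of even vertices $\{g_{p+1},\dots,g_n\}$, every edge joining an odd and an even vertex. For the principal eigenvector $y=(y_1,\dots,y_n)$ the odd standard vector is $y_\bullet=(y_1,\dots,y_p,0,\dots,0)$ and the even standard vector is $y_\circ=(0,\dots,0,y_{p+1},\dots,y_n)$. For each $i$ let $\sigma_{g_i}:V_G\to V_G$ be the linear map with $(\sigma_{g_i}(x))_j=x_j$ for $j\ne i$ and $(\sigma_{g_i}(x))_i=-x_i+\sum_{j:\,g_j\in M(g_i)}x_j$. Put $\overset{\bullet}{c}=\sigma_{g_p}\cdots\sigma_{g_1}$ (product over odd vertices) and $\overset{\circ}{c}=\sigma_{g_n}\cdots\sigma_{g_{p+1}}$ (product over even vertices). For $t>0$, $c_t=\cdots\overset{\bullet}{c}\,\overset{\circ}{c}\,\overset{\bullet}{c}$ is the alternating product of $t$ factors whose rightmost (first applied) factor is $\overset{\bullet}{c}$; for $t<0$, $c_t=\cdots\overset{\circ}{c}\,\overset{\bullet}{c}\,\overset{\circ}{c}$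 is the alternating product of $|t|$ factors whose rightmost factor is $\overset{\circ}{c}$; $c_0=\mathrm{id}$. For $v,w\in V_G$, $v\simeq w$ means that $v$ and $w$ are linearly dependent. For real $r\ge 4$ the function $\rho_r$ on nonnegative integers is defined by $\rho_r(0)=0$, $\rho_r(n+1)=\dfrac{r}{r-\rho_r(n)}$. *)

(* Defs.v *)
From HB Require Import structures.
From mathcomp Require Import all_boot all_order all_algebra.
From mathcomp Require Import boolp classical_sets reals.

Set Implicit Arguments.
Unset Strict Implicit.
Unset Printing Implicit Defensive.

Import Order.TTheory GRing.Theory Num.Theory.
Local Open Scope ring_scope.

(* The vertex g_(i+1) is the ordinal i : 'I_n. *)
Record sgraph (n : nat) := SGraph {
  adj : rel 'I_n;
  adj_sym : symmetric adj;
  adj_irr : irreflexive adj }.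

Definition connected_graph (n : nat) (G : sgraph n) : Prop :=
  (0 < n)%N /\ forall i j : 'I_n, connect (adj G) i j.

(* The vertices i < p are the odd ones, the vertices p <= i the even ones. *)
Definition bipartite (n : nat) (G : sgraph n) (p : nat) : Prop :=
  (p <= n)%N /\ forall i j : 'I_n, adj G i j -> (i < p)%N != (j < p)%N.

Definition neighbors (n : nat) (G : sgraph n) (i : 'I_n) : {set 'I_n} :=
  [set j | adj G i j]%SET.

Definition adjmx (R : realType) (n : nat) (G : sgraph n) : 'M[R]_n :=
  \matrix_(i, j) (adj G i j)%:R.

Definition largest_eigenvalue (R : realType) (n : nat) (A : 'M[R]_n) (a : R)
  : Prop :=
  eigenvalue A a /\ forall b : R, eigenvalue A b -> b <= a.

(* The default 0 is reached only when there is no eigenvalue, i.e. n = 0,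
   since A_G is real symmetric. *)
Definition ind (R : realType) (n : nat) (G : sgraph n) : R :=
  xget 0 [set a | largest_eigenvalue (adjmx R G) a]%classic.

(* Acting on row vectors is harmless: A_G is symmetric. *)
Definition principal_eigenvector (R : realType) (n : nat) (G : sgraph n)
  (y : 'rV[R]_n) : Prop :=
  (forall i, 0 < y 0 i) /\ y *m adjmx R G = ind R G *: y.

Definition odd_part (R : realType) (n p : nat) (y : 'rV[R]_n) : 'rV[R]_n :=
  \row_i (if (i < p)%N then y 0 i else 0).

Definition even_part (R : realType) (n p : nat) (y : 'rV[R]_n) : 'rV[R]_n :=
  \row_i (if (i < p)%N then 0 else y 0 i).

Definition sigma (R : realType) (n : nat) (G : sgraph n) (i : 'I_n)
  (x : 'rV[R]_n) : 'rV[R]_n :=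
  \row_j (if j == i then - x 0 i + \sum_(k in neighbors G i) x 0 k
          else x 0 j).

(* The head of s is applied first: sigma_(s_k) ... sigma_(s_1). *)
Definition sigma_seq (R : realType) (n : nat) (G : sgraph n) (s : seq 'I_n)
  (x : 'rV[R]_n) : 'rV[R]_n :=
  foldl (fun z i => sigma G i z) x s.

Definition c_odd (R : realType) (n : nat) (G : sgraph n) (p : nat)
  : 'rV[R]_n -> 'rV[R]_n :=
  sigma_seq G [seq i : 'I_n <- enum 'I_n | (i < p)%N].

Definition c_even (R : realType) (n : nat) (G : sgraph n) (p : nat)
  : 'rV[R]_n -> 'rV[R]_n :=
  sigma_seq G [seq i : 'I_n <- enum 'I_n | (p <= i)%N].

(* ... f g f with k factors, f being applied first. *)
Fixpoint alternating (V : Type) (f g : V -> V) (k : nat) (x : V) : V :=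
  if k is k'.+1 then alternating g f k' (f x) else x.

Definition coxeter (R : realType) (n : nat) (G : sgraph n) (p : nat) (t : int)
  : 'rV[R]_n -> 'rV[R]_n :=
  if 0 <= t then alternating (@c_odd R n G p) (@c_even R n G p) `|t|%N
  else alternating (@c_even R n G p) (@c_odd R n G p) `|t|%N.

Definition lindep (R : realType) (n : nat) (v w : 'rV[R]_n) : Prop :=
  ~~ free [:: v; w].

Fixpoint rho (R : realType) (r : R) (n : nat) : R :=
  if n is n'.+1 then r / (r - rho r n') else 0.

(* Main.v *)
(* Write s = ind G.  On the plane spanned by y_odd and y_even the vertices of one
   colour are pairwise non-adjacent, so their reflections act simultaneously: the
   coefficient b on that colour becomes s a - b, where a is the other coefficient.
   Starting from (1, 0), the coefficients after k factors are therefore consecutive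
   terms u_k, u_(k+1) of the sequence u_0 = 0, u_1 = 1, u_(k+2) = s u_(k+1) - u_k,
   and rho_r(k) = s u_k / u_(k+1) because both sides obey the same recursion.  The
   condition s >= 2 makes u increasing, so no denominator vanishes. *)

Require Import Defs.
From HB Require Import structures.
From mathcomp Require Import all_boot all_order all_algebra.
From mathcomp Require Import boolp classical_sets reals zify ring lra.

Set Implicit Arguments.
Unset Strict Implicit.
Unset Printing Implicit Defensive.

Import Order.TTheory GRing.Theory Num.Theory.
Local Open Scope ring_scope.

(** The sequence u_k: for k >= 1 it is the Chebyshev polynomial of the second kind U_(k-1),
    evaluated at s/2. *)
Fixpoint chebU (R : pzRingType) (s : R) (k : nat) : R :=
  if k is k'.+1 then
    if k' is k''.+1 then s * chebU s k' - chebU s k'' else 1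
  else 0.

Lemma chebUSS (R : pzRingType) (s : R) (k : nat) :
  chebU s k.+2 = s * chebU s k.+1 - chebU s k.
Proof. by []. Qed.

(** Induction on u_(k+2) - u_(k+1) = (s - 2) u_(k+1) + (u_(k+1) - u_k). *)
Lemma chebU_lt (R : realFieldType) (s : R) (k : nat) :
  2 <= s -> 0 <= chebU s k < chebU s k.+1.
Proof.
move=> s_ge2; elim: k => [|k /andP[u_ge0 ult]]; first by rewrite /= lexx ltr01.
by rewrite chebUSS; apply/andP; split; nra.
Qed.

Lemma chebU_gt0 (R : realFieldType) (s : R) (k : nat) :
  2 <= s -> 0 < chebU s k.+1.
Proof. by move=> /(chebU_lt k)/andP[/le_lt_trans]; apply. Qed.

Lemma rho_chebU (R : realType) (s : R) (k : nat) :
  2 <= s -> rho (s ^+ 2) k = s * chebU s k / chebU s k.+1.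
Proof.
move=> s_ge2; elim: k => [|k IHk]; first by rewrite /= mulr0 mul0r.
have u1 := chebU_gt0 k s_ge2; have u2 := chebU_gt0 k.+1 s_ge2.
rewrite [LHS]/= IHk chebUSS; rewrite chebUSS in u2.
field; rewrite (gt_eqF u1) (gt_eqF u2) /=.
(* The remaining denominator is [s ^+ 2 - rho (s ^+ 2) k] times u_(k+1), which equals s u_(k+2). *)
have -> : s ^+ 2 * chebU s k.+1 - s * chebU s k
          = s * (s * chebU s k.+1 - chebU s k) by ring.
by rewrite mulf_neq0 ?(gt_eqF u2) //; apply/eqP; lra.
Qed.

(** The starting index [j] is arbitrary so that the induction closes: one application of [f] raises
    [j] by one and exchanges [f] with [g] and [x] with [z]. *)
Lemma alternating_chebU (R : pzRingType) (V : lmodType R) (s : R) (k j : nat)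
    (f g : V -> V) (x z : V) :
    (forall a b, f (a *: x + b *: z) = a *: x + (s * a - b) *: z) ->
    (forall a b, g (a *: z + b *: x) = a *: z + (s * a - b) *: x) ->
  alternating f g k (chebU s j.+1 *: x + chebU s j *: z) =
  if odd k then chebU s (k + j) *: x + chebU s (k + j).+1 *: z
  else chebU s (k + j).+1 *: x + chebU s (k + j) *: z.
Proof.
elim: k j f g x z => [//|k IHk] j f g x z fE gE.
rewrite -[LHS]/(alternating g f k (f _)) fE -chebUSS [X in alternating _ _ _ X]addrC.
rewrite (IHk j.+1 g f z x gE fE) addSnnS oddS.
by case: (odd k); rewrite addrC.
Qed.

Lemma lindep_scale (R : realType) (n : nat) (k : R) (w : 'rV[R]_n) :
  lindep (k *: w) w.
Proof.
by rewrite /lindep free_cons negb_and negbK memvZ // memv_span ?mem_head.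
Qed.

Section AlternatingRatio.

Variables (R : realType) (n : nat) (s : R) (f g : 'rV[R]_n -> 'rV[R]_n).
Variables x z : 'rV[R]_n.
Hypothesis s_ge2 : 2 <= s.
Hypothesis fE : forall a b, f (a *: x + b *: z) = a *: x + (s * a - b) *: z.
Hypothesis gE : forall a b, g (a *: z + b *: x) = a *: z + (s * a - b) *: x.

Let s_neq0 : s != 0.
Proof. by apply/eqP; move: s_ge2 => /[swap] ->; lra. Qed.

Let alternating_start k :
  alternating f g k x =
  if odd k then chebU s k *: x + chebU s k.+1 *: z
  else chebU s k.+1 *: x + chebU s k *: z.
Proof.
by rewrite -[x in LHS]addr0 -[x in LHS]scale1r -(scale0r z)
  (alternating_chebU k 0 fE gE) addn0.
Qed.

Lemma lindep_alternating_odd (k : nat) : odd k ->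
  lindep (alternating f g k x) (x + (s / rho (s ^+ 2) k) *: z).
Proof.
(* Oddness rules out k = 0, where [rho] and the scaling factor u_k both vanish. *)
case: k => // k odd_k; rewrite alternating_start odd_k rho_chebU //.
have u1 := chebU_gt0 k s_ge2; have u2 := chebU_gt0 k.+1 s_ge2.
suff -> : chebU s k.+1 *: x + chebU s k.+2 *: z = chebU s k.+1 *:
    (x + (s / (s * chebU s k.+1 / chebU s k.+2)) *: z) by exact: lindep_scale.
rewrite scalerDr scalerA; congr (_ + _ *: _).
by field; rewrite s_neq0 (gt_eqF u1) (gt_eqF u2).
Qed.

Lemma lindep_alternating_even (k : nat) : ~~ odd k ->
  lindep (alternating f g k x) (x + (rho (s ^+ 2) k / s) *: z).
Proof.
move=> /negbTE even_k; rewrite alternating_start even_k rho_chebU //.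
have u1 := chebU_gt0 k s_ge2.
suff -> : chebU s k.+1 *: x + chebU s k *: z = chebU s k.+1 *:
    (x + (s * chebU s k / chebU s k.+1 / s) *: z) by exact: lindep_scale.
rewrite scalerDr scalerA; congr (_ + _ *: _).
by field; rewrite s_neq0 (gt_eqF u1).
Qed.

End AlternatingRatio.

(* Distinct non-adjacent reflections do not see each other, so their product is
   the simultaneous update. *)
Lemma sigma_seqE (R : realType) (n : nat) (G : sgraph n) (l : seq 'I_n)
    (x : 'rV[R]_n) (j : 'I_n) :
    uniq l -> {in l &, forall i k, ~~ adj G i k} ->
  sigma_seq G l x 0 j =
  if j \in l then - x 0 j + \sum_(k in neighbors G j) x 0 k else x 0 j.
Proof.
elim: l x => [//|i l IHl] x /= /andP[iNl uniq_l] indep.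
rewrite -[LHS]/(sigma_seq G l (sigma G i x) 0 j) IHl //; last first.
  by move=> a b al bl; apply: indep; rewrite inE ?al ?bl orbT.
rewrite inE !mxE; case: (eqVneq j i) => [->|jNi] /=; first by rewrite (negbTE iNl).
case: ifP => // jl; congr (_ + _); apply: eq_bigr => k; rewrite inE => jk.
rewrite mxE; case: eqP jk => // -> ji.
by have := indep j i; rewrite !inE jl eqxx orbT ji => /(_ isT isT).
Qed.

Section Bipartite.

Variables (R : realType) (n p : nat) (G : sgraph n) (y : 'rV[R]_n).
Hypothesis Gbip : bipartite G p.
Hypothesis hy : principal_eigenvector G y.

(** Coordinate [i] of the eigenvector equation; symmetry of adjacency turns column [i] of the matrix
    into the neighbours of [i]. *)
Lemma sum_neighbors_principal (i : 'I_n) :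
  \sum_(k in neighbors G i) y 0 k = ind R G * y 0 i.
Proof.
have [_ /matrixP/(_ 0 i)] := hy; rewrite !mxE => <-.
rewrite big_mkcond /=; apply: eq_bigr => k _.
by rewrite inE mxE adj_sym; case: adj; rewrite ?mulr1 ?mulr0.
Qed.

Lemma adj_odd (i k : 'I_n) : adj G i k -> (k < p)%N = ~~ (i < p)%N.
Proof. by case: Gbip => _ bip /bip; case: (i < p)%N; case: (k < p)%N. Qed.

Lemma c_odd_standard (a b : R) :
  c_odd G p (a *: even_part p y + b *: odd_part p y) =
  a *: even_part p y + (ind R G * a - b) *: odd_part p y.
Proof.
apply/rowP => j; rewrite /c_odd sigma_seqE; last first.
  move=> i k; rewrite !mem_filter => /andP[ip _] /andP[kp _].
  by apply/negP => /adj_odd; rewrite ip kp.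
  exact: filter_uniq (enum_uniq _).
rewrite mem_filter mem_enum andbT !mxE; case: ifP => jp; rewrite ?jp;
  last by rewrite !mulr0.
(* All neighbours of the odd vertex [j] are even, so the sum only sees the term with coefficient
   [a]. *)
have -> : \sum_(k in neighbors G j)
    (a *: even_part p y + b *: odd_part p y) 0 k = a * (ind R G * y 0 j).
  rewrite -sum_neighbors_principal mulr_sumr; apply: eq_bigr => k.
  by rewrite inE !mxE => /adj_odd ->; rewrite jp /= mulr0 addr0.
by ring.
Qed.

Lemma c_even_standard (a b : R) :
  c_even G p (a *: odd_part p y + b *: even_part p y) =
  a *: odd_part p y + (ind R G * a - b) *: even_part p y.
Proof.
apply/rowP => j; rewrite /c_even sigma_seqE; last first.
  move=> i k; rewrite !mem_filter => /andP[ip _] /andP[kp _].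
  by apply/negP => /adj_odd; rewrite !ltnNge ip kp.
  exact: filter_uniq (enum_uniq _).
rewrite mem_filter mem_enum andbT leqNgt !mxE; case jp: (j < p)%N; rewrite /= ?jp;
  first by rewrite !mulr0.
have -> : \sum_(k in neighbors G j)
    (a *: odd_part p y + b *: even_part p y) 0 k = a * (ind R G * y 0 j).
  rewrite -sum_neighbors_principal mulr_sumr; apply: eq_bigr => k.
  by rewrite inE !mxE => /adj_odd ->; rewrite jp /= mulr0 addr0.
by ring.
Qed.

(** At any vertex, [ind R G] times a positive coordinate is a sum of positive coordinates. This sign
    selects the root [ind R G] of r, hence [ind R G] >= 2. *)
Lemma ind_ge0 : (0 < n)%N -> 0 <= ind R G.
Proof.
move=> n_gt0; have [y_gt0 _] := hy.
rewrite -(pmulr_lge0 _ (y_gt0 (Ordinal n_gt0))) -sum_neighbors_principal.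
by apply: sumr_ge0 => k _; apply: ltW.
Qed.

End Bipartite.

Lemma coxeter_nat (R : realType) (n p : nat) (G : sgraph n) (k : nat)
    (x : 'rV[R]_n) :
  coxeter G p k%:Z x = alternating (c_odd G p) (c_even G p) k x.
Proof. by []. Qed.

Lemma coxeter_oppn (R : realType) (n p : nat) (G : sgraph n) (k : nat)
    (x : 'rV[R]_n) : (0 < k)%N ->
  coxeter G p (- k%:Z) x = alternating (c_even G p) (c_odd G p) k x.
Proof. by case: k. Qed.

Theorem proposition3p1 (R : realType) (n p : nat) (G : sgraph n)
  (Gconn : connected_graph G) (Gbip : bipartite G p)
  (r : R) (rE : r = ind R G ^+ 2) (r_ge4 : 4 <= r)
  (y : 'rV[R]_n) (hy : principal_eigenvector G y)
  (t : nat) (ht : (1 <= t)%N) :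
  let yo := odd_part p y in
  let ye := even_part p y in
  [/\ lindep (coxeter G p (2 * t%:Z - 1) ye)
             (ye + (Num.sqrt r / rho r (2 * t - 1)%N) *: yo),
      lindep (coxeter G p (2 * t%:Z) ye)
             (ye + (rho r (2 * t)%N / Num.sqrt r) *: yo),
      lindep (coxeter G p (- (2 * t%:Z + 1)) yo)
             (yo + (Num.sqrt r / rho r (2 * t + 1)%N) *: ye)
    & lindep (coxeter G p (- (2 * t%:Z)) yo)
             (yo + (rho r (2 * t)%N / Num.sqrt r) *: ye)].
Proof.
move=> yo ye.
have s_ge0 := ind_ge0 hy (proj1 Gconn).
have s_ge2 : 2 <= ind R G by nra.
have sqrt_r : Num.sqrt r = ind R G by rewrite rE sqrtr_sqr ger0_norm.
have c_oddE := c_odd_standard Gbip hy; have c_evenE := c_even_standard Gbip hy.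
rewrite sqrt_r rE.
(* The truncated subtraction is exact because t >= 1. *)
have -> : 2 * t%:Z - 1 = (2 * t - 1)%N%:Z by lia.
have -> : 2 * t%:Z + 1 = (2 * t + 1)%N%:Z by lia.
have -> : 2 * t%:Z = (2 * t)%N%:Z by lia.
rewrite !coxeter_nat !coxeter_oppn ?addn1 ?muln_gt0 //.
(* The last two claims are the first two with the colours exchanged. *)
split; [apply: lindep_alternating_odd | apply: lindep_alternating_even
  | apply: lindep_alternating_odd | apply: lindep_alternating_even] => //; lia.
Qed.
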